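(* Fix a profile pseudometric $\delta$ and a collection $\Sigma$ of feed models. For every set $\Gamma\cup\{\varphi\}\subseteq\mathcal{L}_D$ of formulas, $\Gamma\vdash_{H_{\mathsf D}}\varphi$ if and only if $\Gamma\models\varphi$, where $\models$ is local semantic consequence over network models (relative to $\delta$).
   Context: Fix a positive integer $m$ and $G=\{0,\frac1m,\ldots,1\}$; $r\oplus s=\min\{1,r+s\}$ for $r,s\in G$; for $x\in[0,1]$, $\lceil x\rceil_G:=\min\{r\in G:x\le r\}$. Let $A$ be a finite nonempty set of agents, $P$ a nonempty finite set of propositional atoms, $\Omega$ a finite set of nominals, $P\cap\Omega=\varnothing$, $|\Omega|=|A|$. Profile pseudometric: a fixed $\delta:\wp(P)\times\wp(P)\to[0,1]$ with $\delta(S,S)=0$, $\delta(S,T)=\delta(T,S)$, $\delta(S,U)\le\delta(S,T)+\delta(T,U)$ for all $S,T,U\subseteq P$ (taken to be effectively presented, i.e. the comparisons $\lceil\delta(S,T)\rceil_G\le r$ are decidable). Static network model: $M=(A,(\sim_r)_{r\in G},V)$ where $V:P\cup\Omega\to\wp(A)$, each $V(i)$ ($i\in\Omega$) is a singleton and $i\mapsto$ (the unique member of $V(i)$) is a bijection $\Omega\to A$; the relations $\sim_r\subseteq A\times A$ satisfy, for all $a,b,c\in A$ and $r,s\in G$: $a\sim_r a$; $a\sim_r b\Leftrightarrow b\sim_r a$; $a\sim_1 b$; $a\sim_r b\Rightarrow a\sim_s b$ for $r\le s$; $a\sim_r b$ and $b\sim_s c$ imply $a\sim_{r\oplus s}c$.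 Profile: $S_V(a):=\{p\in P:a\in V(p)\}$, also written $S_N(a)$ if $V$ is the valuation of $N$. Network model (relative to $\delta$): $N=(A,(\sim_r)_{r\in G},V)$ with $V$ satisfying the same naming condition and $a\sim_r b$ iff $\lceil\delta(S_N(a),S_N(b))\rceil_G\le r$, for all $a,b\in A$, $r\in G$. (Every network model is a static network model.) Static language $\mathcal{L}_0$: $\varphi::=p\mid i\mid\neg\varphi\mid(\varphi\land\psi)\mid\langle r\rangle\varphi\mid@_i\varphi$ ($p\in P,i\in\Omega,r\in G$); $[r]\varphi:=\neg\langle r\rangle\neg\varphi$; other connectives, $\top$, $\bot$ as usual. Semantics: $M,a\models p$ iff $a\in V(p)$; $M,a\models i$ iff $a\in V(i)$; Boolean clauses as usual; $M,a\models\langle r\rangle\varphi$ iff $M,b\models\varphi$ for some $b$ with $a\sim_r b$; $M,a\models@_i\varphi$ iff $M,b\models\varphi$ where $V(i)=\{b\}$. For $\chi\in\mathcal{L}_0$, $\models\chi$ means $\chi$ is true at every agent of every static network model. Feed model: $\mathcal{F}=(E,\mathrm{pre},\mathrm{post})$ with $E$ a finite nonempty set of events, $\mathrm{pre}:E\to\mathcal{L}_0$, $\mathrm{post}:E\times P\to\mathcal{L}_0$ total, $\models\bigvee_{e\in E}\mathrm{pre}(e)$, and $\models\neg(\mathrm{pre}(e)\land\mathrm{pre}(f))$ for $e\ne f$ in $E$. For a network model $M$ and $a\in A$ let $e_a$ be the unique event with $M,a\models\mathrm{pre}(e_a)$. Update: $M\otimes\mathcal{F}=(A,(\sim^\otimes_r)_{r\in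 G},V^\otimes)$ with $a\in V^\otimes(p)$ iff $M,a\models\mathrm{post}(e_a,p)$ ($p\in P$), $V^\otimes(i)=V(i)$ ($i\in\Omega$), and $a\sim^\otimes_r b$ iff $\lceil\delta(S_{V^\otimes}(a),S_{V^\otimes}(b))\rceil_G\le r$. Dynamic language $\mathcal{L}_D$: the grammar of $\mathcal{L}_0$ plus $[\mathcal{F}]\varphi$ for $\mathcal{F}\in\Sigma$. Formulas are evaluated at agents of network models, with the static clauses above and $M,a\models[\mathcal{F}]\varphi$ iff $M\otimes\mathcal{F},a\models\varphi$. $\Gamma\models\varphi$ iff for every network model $M$ and agent $a$, if $M,a\models\gamma$ for all $\gamma\in\Gamma$ then $M,a\models\varphi$. Auxiliary formulas (empty conjunction is $\top$): for $S\subseteq P$, $\pi_S:=\bigwedge_{p\in S}p\land\bigwedge_{p\in P\setminus S}\neg p$; $\mathbb{P}^{\mathcal{F}}_S(i):=@_i\bigwedge_{e\in E}\bigl(\mathrm{pre}(e)\to(\bigwedge_{p\in S}\mathrm{post}(e,p)\land\bigwedge_{p\in P\setminus S}\neg\mathrm{post}(e,p))\bigr)$; $\mathbb{T}^{\mathcal{F}}_r(i,j):=\bigvee_{S,T\subseteq P,\ \lceil\delta(S,T)\rceil_G\le r}(\mathbb{P}^{\mathcal{F}}_S(i)\land\mathbb{P}^{\mathcal{F}}_T(j))$. System $H_0$: propositional tautologies and the schemes ($r,s\in G$, $i,j\in\Omega$): $(T_r)$ $[r]\varphi\to\varphi$; $(B_r)$ $\varphi\to[r]\langle r\rangle\varphi$;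 (Mon) $[s]\varphi\to[r]\varphi$ for $r\le s$; (Tri) $[r\oplus s]\varphi\to[r][s]\varphi$; (Bd) $@_i\langle1\rangle j$; (Name) $\bigvee_{i\in\Omega}i$; $(\mathrm{Paste}_r)$ $@_i\langle r\rangle\varphi\leftrightarrow\bigvee_{j\in\Omega}(@_i\langle r\rangle j\land@_j\varphi)$; $(K_@)$ $@_i(\varphi\to\psi)\to(@_i\varphi\to@_i\psi)$; (Self) $\neg@_i\varphi\leftrightarrow@_i\neg\varphi$; $(\mathrm{Ref}_@)$ $@_ii$; (Agree) $@_i@_j\varphi\leftrightarrow@_j\varphi$; $(\mathrm{Conj}_@)$ $@_i(\varphi\land\psi)\leftrightarrow(@_i\varphi\land@_i\psi)$; (Locality) $i\to(\varphi\leftrightarrow@_i\varphi)$; (Dist) $@_i\neg j$ for $i\neq j$; with rules modus ponens, replacement (from $\vdash\varphi\leftrightarrow\psi$ infer $\vdash C[\varphi]\leftrightarrow C[\psi]$, $C[\cdot]$ any one-place formula context), necessitation (from $\vdash\varphi$ infer $\vdash[r]\varphi$), and $(\mathrm{Gen}_@)$ (from $\vdash\varphi$ infer $\vdash@_i\varphi$). System $H_{\mathsf D}$ (formulas now in $\mathcal{L}_D$) extends $H_0$ by replacement of provable equivalents in arbitrary $\mathcal{L}_D$-contexts and the schemes, for $r\in G$, $\mathcal{F}=(E,\mathrm{pre},\mathrm{post})\in\Sigma$: $(\mathrm{Net}_r)$ $\langle r\rangle\varphi\leftrightarrow\bigvee_{S,T\subseteq P,\ \lceil\delta(S,T)\rceil_G\le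 r}\bigl(\pi_S\land\bigvee_{j\in\Omega}@_j(\pi_T\land\varphi)\bigr)$; $[\mathcal{F}]p\leftrightarrow\bigwedge_{e\in E}(\mathrm{pre}(e)\to\mathrm{post}(e,p))$; $[\mathcal{F}]i\leftrightarrow i$; $[\mathcal{F}]\neg\varphi\leftrightarrow\neg[\mathcal{F}]\varphi$; $[\mathcal{F}](\varphi\land\psi)\leftrightarrow([\mathcal{F}]\varphi\land[\mathcal{F}]\psi)$; $[\mathcal{F}]@_i\varphi\leftrightarrow@_i[\mathcal{F}]\varphi$; $[\mathcal{F}]\langle r\rangle\varphi\leftrightarrow\bigvee_{i,j\in\Omega}\bigl(i\land\mathbb{T}^{\mathcal{F}}_r(i,j)\land@_j[\mathcal{F}]\varphi\bigr)$. $\Gamma\vdash_{H_{\mathsf D}}\varphi$ means $\varphi$ is derivable from members of $\Gamma$ and theorems of $H_{\mathsf D}$ by modus ponens; all other rules apply only to theorems. *)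

(* Defs.v *)
From mathcomp Require Import all_boot all_order all_algebra.
From mathcomp Require Import reals.

Set Implicit Arguments.
Unset Strict Implicit.
Unset Printing Implicit Defensive.

Import Order.TTheory GRing.Theory Num.Theory.

(* The ordinal [r : 'I_m.+1] stands for the grid point r/m of
   G = {0, 1/m, ..., 1}, where m is [grid]. *)
Record signature := Signature {
  grid : nat;
  agent : finType;
  atom : finType;
  nominal : finType;
  grid_gt0 : 0 < grid;
  agent_gt0 : 0 < #|agent|;
  atom_gt0 : 0 < #|atom|;
  card_nominal : #|nominal| = #|agent| }.

Definition threshold (L : signature) := 'I_(grid L).+1.

Definition tval (L : signature) (R : realType) (r : threshold L) : R :=
  (r%:R / (grid L)%:R)%R.

Definition oplus (L : signature) (r s : threshold L) : threshold L :=
  inord (minn (grid L) (r + s)).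

(* [x] is meant to lie in [0,1], so that 1 = [tval ord_max] is a candidate. *)
Definition ceilG (L : signature) (R : realType) (x : R) : threshold L :=
  [arg min_(r < (ord_max : threshold L) | (x <= tval R r)%R) (r : nat)]%N.

Record pseudometric (L : signature) (R : realType) := Pseudometric {
  dist :> {set atom L} -> {set atom L} -> R;
  dist_itv : forall S T, (0 <= dist S T <= 1)%R;
  dist_refl : forall S, dist S S = 0%R;
  dist_sym : forall S T, dist S T = dist T S;
  dist_tri : forall S T U, (dist S U <= dist S T + dist T U)%R }.

Definition close (L : signature) (R : realType) (delta : pseudometric L R)
    (r : threshold L) (S T : {set atom L}) : bool :=
  (ceilG L (delta S T) <= r)%N.

(* One grammar for both languages: [X] is the type of labels of dynamic
   modalities, empty for L_0 and the feed models of Sigma for L_D. *)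
Inductive formula (L : signature) (X : Type) : Type :=
| Atom of atom L
| Nom of nominal L
| Neg of formula L X
| And of formula L X & formula L X
| Dia of threshold L & formula L X
| At of nominal L & formula L X
| Upd of X & formula L X.

Arguments Atom {L X} p.
Arguments Nom {L X} i.
Arguments And {L X} phi psi : rename.

Definition L0 (L : signature) := formula L void.

Section Connectives.
Context {L : signature} {X : Type}.
Implicit Types phi psi : formula L X.

Definition Or phi psi := Neg (And (Neg phi) (Neg psi)).
Definition Imp phi psi := Neg (And phi (Neg psi)).
Definition Iff phi psi := And (Imp phi psi) (Imp psi phi).
Definition Bot : formula L X :=
  let p := enum_val (Ordinal (atom_gt0 L)) in And (Atom p) (Neg (Atom p)).
Definition Top : formula L X := Neg Bot.
Definition Box (r : threshold L) phi := Neg (Dia r (Neg phi)).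

End Connectives.

Fixpoint embed (L : signature) (X : Type) (phi : L0 L) : formula L X :=
  match phi with
  | Atom p => Atom p
  | Nom i => Nom i
  | Neg phi1 => Neg (embed X phi1)
  | And phi1 phi2 => And (embed X phi1) (embed X phi2)
  | Dia r phi1 => Dia r (embed X phi1)
  | At i phi1 => At i (embed X phi1)
  | Upd F _ => of_void _ F
  end.

Record structure (L : signature) := Structure {
  near : threshold L -> rel (agent L);
  valu : atom L + nominal L -> {set agent L} }.

Definition naming (L : signature)
    (V : atom L + nominal L -> {set agent L}) : Prop :=
  exists2 f : nominal L -> agent L,
    bijective f & forall i, V (inr i) = [set f i].

Definition profile (L : signature)
    (V : atom L + nominal L -> {set agent L}) (a : agent L) : {set atom L} :=
  [set p | a \in V (inl p)].

Record static_model (L : signature) := StaticModel {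
  static_str :> structure L;
  static_naming : naming (valu static_str);
  static_refl : forall r a, near static_str r a a;
  static_sym : forall r a b, near static_str r a b <-> near static_str r b a;
  static_bound : forall a b, near static_str ord_max a b;
  static_mono : forall (r s : threshold L) a b, (r <= s)%N ->
    near static_str r a b -> near static_str s a b;
  static_tri : forall r s a b c,
    near static_str r a b -> near static_str s b c ->
    near static_str (oplus r s) a c }.

Record network_model (L : signature) (R : realType)
    (delta : pseudometric L R) := NetworkModel {
  network_str :> structure L;
  network_naming : naming (valu network_str);
  network_near : forall r a b, near network_str r a b <->
    close delta r (profile (valu network_str) a) (profile (valu network_str) b)
  }.

(* The semantics of both languages: [K] is the class of models, [str] the
   underlying structure, and [upd] the update used by the dynamic clause. *)
Fixpoint eval (L : signature) (X K : Type) (str : K -> structure L)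
    (upd : K -> X -> K) (phi : formula L X) (M : K) (a : agent L) : bool :=
  match phi with
  | Atom p => a \in valu (str M) (inl p)
  | Nom i => a \in valu (str M) (inr i)
  | Neg phi1 => ~~ eval str upd phi1 M a
  | And phi1 phi2 => eval str upd phi1 M a && eval str upd phi2 M a
  | Dia r phi1 => [exists b, near (str M) r a b && eval str upd phi1 M b]
  | At i phi1 =>
      [exists b, (valu (str M) (inr i) == [set b]) && eval str upd phi1 M b]
  | Upd F phi1 => eval str upd phi1 (upd M F) a
  end.

Definition sat0 (L : signature) (M : structure L) (a : agent L)
    (phi : L0 L) : bool :=
  eval id (fun _ F => of_void _ F) phi M a.

Definition valid0 (L : signature) (chi : L0 L) : Prop :=
  forall (M : static_model L) (a : agent L), sat0 M a chi.

Record feed_model (L : signature) := FeedModel {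
  event : finType;
  event_gt0 : 0 < #|event|;
  pre : event -> L0 L;
  post : event -> atom L -> L0 L;
  pre_cover : valid0 (\big[Or/Bot]_(e : event) pre e);
  pre_disjoint : forall e f : event, e != f ->
    valid0 (Neg (And (pre e) (pre f))) }.

Lemma ceilG_le (L : signature) (R : realType) (x : R) (r : threshold L) :
  (x <= 1)%R -> (ceilG L x <= r)%N = (x <= tval R r)%R.
Proof.
move=> x1; have m0 : (0 < (grid L)%:R :> R)%R by rewrite ltr0n grid_gt0.
rewrite /ceilG; case: arg_minnP => [|s xs smin].
  by rewrite /tval /= divff ?gt_eqF.
apply/idP/idP => [sr|]; last exact: smin.
by rewrite (le_trans xs)// /tval ler_pM2r ?invr_gt0// ler_nat.
Qed.

Lemma close_le (L : signature) (R : realType) (delta : pseudometric L R)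
    (r : threshold L) (S T : {set atom L}) :
  close delta r S T = (delta S T <= tval R r)%R.
Proof. by rewrite /close ceilG_le//; case/andP: (dist_itv delta S T). Qed.

Lemma close_refl (L : signature) (R : realType) (delta : pseudometric L R)
    (r : threshold L) (S : {set atom L}) : close delta r S S.
Proof. by rewrite close_le dist_refl divr_ge0 ?ler0n. Qed.

Lemma close_tri (L : signature) (R : realType) (delta : pseudometric L R)
    (r s : threshold L) (S T U : {set atom L}) :
  close delta r S T -> close delta s T U -> close delta (oplus r s) S U.
Proof.
rewrite !close_le => rST sTU.
have m0 : (0 < (grid L)%:R :> R)%R by rewrite ltr0n grid_gt0.
rewrite /tval inordK ?ltnS ?geq_minl//.
have [_|_] := leqP (grid L) (r + s).
  by rewrite divff ?gt_eqF//; case/andP: (dist_itv delta S U).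
by rewrite natrD mulrDl (le_trans (dist_tri delta S T U))// lerD.
Qed.

Definition network_static (L : signature) (R : realType)
    (delta : pseudometric L R) (N : network_model delta) : static_model L.
Proof.
apply: (@StaticModel L N (network_naming N)).
- by move=> r a; apply/network_near; apply: close_refl.
- move=> r a b; split=> /network_near h; apply/network_near;
    by move: h; rewrite /close dist_sym.
- by move=> a b; apply/network_near; rewrite /close -ltnS.
- move=> r s a b rs /network_near h; apply/network_near.
  exact: leq_trans h rs.
- move=> r s a b c /network_near h /network_near k; apply/network_near.
  exact: close_tri h k.
Defined.

Lemma eval_bigOr (L : signature) (X K : Type) (str : K -> structure L)
    (upd : K -> X -> K) (I : finType) (F : I -> formula L X) (M : K)
    (a : agent L) :
  eval str upd (\big[Or/Bot]_(i : I) F i) M a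
    = [exists i, eval str upd (F i) M a].
Proof.
transitivity (\big[orb/false]_(i : I) eval str upd (F i) M a).
  apply: (big_morph (fun phi => eval str upd phi M a)) => [phi psi|] /=.
    by rewrite negb_and !negbK.
  by rewrite andbN.
by rewrite big_orE.
Qed.

Section Update.
Context (L : signature) (R : realType) (delta : pseudometric L R).

Lemma event_exists (N : network_model delta) (F : feed_model L)
    (a : agent L) : exists e : event F, sat0 N a (pre e).
Proof.
have := pre_cover F (network_static N) a.
by rewrite /sat0 eval_bigOr => /existsP.
Qed.

Lemma event_unique (N : network_model delta) (F : feed_model L)
    (a : agent L) (e f : event F) :
  sat0 N a (pre e) -> sat0 N a (pre f) -> e = f.
Proof.
move=> he hf; apply/eqP; apply: contraT => ef.
have := pre_disjoint ef (network_static N) a.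
by rewrite /sat0 /= -/(sat0 N a (pre e)) -/(sat0 N a (pre f)) he hf.
Qed.

Definition event_at (N : network_model delta) (F : feed_model L)
    (a : agent L) : event F :=
  xchoose (event_exists N F a).

Definition update_val (N : network_model delta) (F : feed_model L)
    (x : atom L + nominal L) : {set agent L} :=
  match x with
  | inl p => [set a | sat0 N a (post (event_at N F a) p)]
  | inr i => valu N (inr i)
  end.

Definition update_str (N : network_model delta) (F : feed_model L) :
    structure L :=
  Structure
    (fun r a b => close delta r (profile (update_val N F) a)
                                (profile (update_val N F) b))
    (update_val N F).

Definition update (N : network_model delta) (F : feed_model L) :
    network_model delta :=
  @NetworkModel L R delta (update_str N F) (network_naming N)
    (fun _ _ _ => iff_refl _).

End Update.

Definition LD (L : signature) (Sigma : feed_model L -> Prop) :=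
  formula L {F : feed_model L | Sigma F}.

Definition sat (L : signature) (R : realType) (delta : pseudometric L R)
    (Sigma : feed_model L -> Prop) (N : network_model delta) (a : agent L)
    (phi : LD Sigma) : bool :=
  eval (@network_str L R delta) (fun M F => update M (proj1_sig F)) phi N a.

Definition entails (L : signature) (R : realType) (delta : pseudometric L R)
    (Sigma : feed_model L -> Prop) (Gamma : LD Sigma -> Prop)
    (phi : LD Sigma) : Prop :=
  forall (N : network_model delta) (a : agent L),
    (forall gamma, Gamma gamma -> sat N a gamma) -> sat N a phi.

(* Formulas whose main operator is not Boolean count as propositional
   letters. *)
Fixpoint teval (L : signature) (X : Type) (v : formula L X -> bool)
    (phi : formula L X) : bool :=
  match phi with
  | Neg phi1 => ~~ teval v phi1
  | And phi1 phi2 => teval v phi1 && teval v phi2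
  | _ => v phi
  end.

Definition tautology (L : signature) (X : Type) (phi : formula L X) : Prop :=
  forall v : formula L X -> bool, teval v phi.

Inductive H0_axiom (L : signature) (X : Type) : formula L X -> Prop :=
| ax_taut phi : tautology phi -> H0_axiom phi
| ax_T r phi : H0_axiom (Imp (Box r phi) phi)
| ax_B r phi : H0_axiom (Imp phi (Box r (Dia r phi)))
| ax_Mon (r s : threshold L) phi : (r <= s)%N ->
    H0_axiom (Imp (Box s phi) (Box r phi))
| ax_Tri r s phi : H0_axiom (Imp (Box (oplus r s) phi) (Box r (Box s phi)))
| ax_Bd i j : H0_axiom (At i (Dia ord_max (Nom j)))
| ax_Name : H0_axiom (\big[Or/Bot]_(i : nominal L) Nom i)
| ax_Paste r i phi :
    H0_axiom (Iff (At i (Dia r phi))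
      (\big[Or/Bot]_(j : nominal L) And (At i (Dia r (Nom j))) (At j phi)))
| ax_KAt i phi psi :
    H0_axiom (Imp (At i (Imp phi psi)) (Imp (At i phi) (At i psi)))
| ax_Self i phi : H0_axiom (Iff (Neg (At i phi)) (At i (Neg phi)))
| ax_RefAt i : H0_axiom (At i (Nom i))
| ax_Agree i j phi : H0_axiom (Iff (At i (At j phi)) (At j phi))
| ax_ConjAt i phi psi :
    H0_axiom (Iff (At i (And phi psi)) (And (At i phi) (At i psi)))
| ax_Locality i phi : H0_axiom (Imp (Nom i) (Iff phi (At i phi)))
| ax_Dist (i j : nominal L) : i != j -> H0_axiom (At i (Neg (Nom j))).

Inductive fcontext (L : signature) (X : Type) : Type :=
| CHole
| CNeg of fcontext L X
| CAndl of fcontext L X & formula L X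
| CAndr of formula L X & fcontext L X
| CDia of threshold L & fcontext L X
| CAt of nominal L & fcontext L X
| CUpd of X & fcontext L X.

Fixpoint plug (L : signature) (X : Type) (C : fcontext L X)
    (phi : formula L X) : formula L X :=
  match C with
  | CHole => phi
  | CNeg C1 => Neg (plug C1 phi)
  | CAndl C1 psi => And (plug C1 phi) psi
  | CAndr psi C1 => And psi (plug C1 phi)
  | CDia r C1 => Dia r (plug C1 phi)
  | CAt i C1 => At i (plug C1 phi)
  | CUpd F C1 => Upd F (plug C1 phi)
  end.

Section SystemHD.
Context (L : signature) (R : realType) (delta : pseudometric L R).
Context (Sigma : feed_model L -> Prop).

Local Notation LD := (LD Sigma).
Local Notation label := {F : feed_model L | Sigma F}.
Local Notation emb := (embed label).

Definition piS (S : {set atom L}) : LD :=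
  And (\big[And/Top]_(p in S) Atom p) (\big[And/Top]_(p in ~: S) Neg (Atom p)).

Definition PF (F : feed_model L) (S : {set atom L}) (i : nominal L) : LD :=
  At i (\big[And/Top]_(e : event F)
    Imp (emb (pre e))
        (And (\big[And/Top]_(p in S) emb (post e p))
             (\big[And/Top]_(p in ~: S) Neg (emb (post e p))))).

Definition TF (F : feed_model L) (r : threshold L) (i j : nominal L) : LD :=
  \big[Or/Bot]_(U : {set atom L} * {set atom L} | close delta r U.1 U.2)
    And (PF F U.1 i) (PF F U.2 j).

Inductive HD_axiom : LD -> Prop :=
| ax_H0 phi : H0_axiom phi -> HD_axiom phi
| ax_Net r phi :
    HD_axiom (Iff (Dia r phi)
      (\big[Or/Bot]_(U : {set atom L} * {set atom L} | close delta r U.1 U.2)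
         And (piS U.1) (\big[Or/Bot]_(j : nominal L) At j (And (piS U.2) phi))))
| ax_UpdAtom (F : label) p :
    HD_axiom (Iff (Upd F (Atom p))
      (\big[And/Top]_(e : event (proj1_sig F))
         Imp (emb (pre e)) (emb (post e p))))
| ax_UpdNom (F : label) i : HD_axiom (Iff (Upd F (Nom i)) (Nom i))
| ax_UpdNeg (F : label) phi :
    HD_axiom (Iff (Upd F (Neg phi)) (Neg (Upd F phi)))
| ax_UpdAnd (F : label) phi psi :
    HD_axiom (Iff (Upd F (And phi psi)) (And (Upd F phi) (Upd F psi)))
| ax_UpdAt (F : label) i phi :
    HD_axiom (Iff (Upd F (At i phi)) (At i (Upd F phi)))
| ax_UpdDia (F : label) r phi :
    HD_axiom (Iff (Upd F (Dia r phi))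
      (\big[Or/Bot]_(ij : nominal L * nominal L)
         And (And (Nom ij.1) (TF (proj1_sig F) r ij.1 ij.2))
             (At ij.2 (Upd F phi)))).

Inductive HD_theorem : LD -> Prop :=
| HD_ax phi : HD_axiom phi -> HD_theorem phi
| HD_mp phi psi : HD_theorem (Imp phi psi) -> HD_theorem phi -> HD_theorem psi
| HD_repl (C : fcontext L label) phi psi : HD_theorem (Iff phi psi) ->
    HD_theorem (Iff (plug C phi) (plug C psi))
| HD_nec r phi : HD_theorem phi -> HD_theorem (Box r phi)
| HD_gen i phi : HD_theorem phi -> HD_theorem (At i phi).

Inductive HD_derives (Gamma : LD -> Prop) : LD -> Prop :=
| der_hyp phi : Gamma phi -> HD_derives Gamma phi
| der_thm phi : HD_theorem phi -> HD_derives Gamma phi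
| der_mp phi psi : HD_derives Gamma (Imp phi psi) -> HD_derives Gamma phi ->
    HD_derives Gamma psi.

End SystemHD.

(* Main.v *)
(** Over a fixed finite set of named agents there are only finitely many states:
    a state is described by a nominal [i] (the current agent) and the set [T] of
    pairs [(j, p)] such that [p] holds at [j].  The [diagram] of a state
    syntactically decides every formula: (Net) eliminates [<r>], and an update
    carries each diagram provably into another diagram.  Each diagram holds at
    some agent of a network model, and the diagrams exhaust all cases up to
    propositional logic and (Name).  Strong completeness follows from soundness:
    every diagram proves [phi] or refutes some member of [Gamma]. *)
Require Import Defs.
From mathcomp Require Import all_boot all_order all_algebra.
From mathcomp Require Import boolp reals.

Set Implicit Arguments.
Unset Strict Implicit.
Unset Printing Implicit Defensive.

(** * Propositional reasoning *)

Section Propositional.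
Context {L : signature} {X : Type}.
Implicit Types (phi psi : formula L X) (v : formula L X -> bool).

Lemma teval_And v phi psi : teval v (And phi psi) = teval v phi && teval v psi.
Proof. by []. Qed.

Lemma teval_Imp v phi psi :
  teval v (Imp phi psi) = (teval v phi ==> teval v psi).
Proof. by rewrite /= negb_and negbK implybE. Qed.

Lemma teval_Iff v phi psi :
  teval v (Iff phi psi) = (teval v phi == teval v psi).
Proof.
by rewrite /Iff [LHS]/= -!/(teval v (Imp _ _)) /=; do 2!case: teval.
Qed.

Lemma teval_bigAnd v (I : finType) (P : pred I) (F : I -> formula L X) :
  teval v (\big[And/Top]_(i | P i) F i) = [forall (i | P i), teval v (F i)].
Proof.
rewrite -big_andE; apply: (big_morph (teval v)) => //=.
by rewrite andbN.
Qed.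

Lemma teval_bigOr v (I : finType) (P : pred I) (F : I -> formula L X) :
  teval v (\big[Or/Bot]_(i | P i) F i) = [exists (i | P i), teval v (F i)].
Proof.
rewrite -big_orE; apply: (big_morph (teval v)) => [phi psi|] /=.
  by rewrite negb_and !negbK.
by rewrite andbN.
Qed.

(** The set [D] is abstract so that the lemma serves both for theorems and for derivations from
    hypotheses. The finitely many premises are moved one by one into the conclusion as antecedents;
    this leaves a tautology, and modus ponens strips the antecedents off again. *)
Lemma tautological_consequence (D : formula L X -> Prop) :
    (forall phi, tautology phi -> D phi) ->
    (forall phi psi, D (Imp phi psi) -> D phi -> D psi) ->
  forall (I : finType) (F : I -> formula L X) psi,
    (forall i, D (F i)) ->
    (forall v, (forall i, teval v (F i)) -> teval v psi) -> D psi.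
Proof.
move=> Dtaut Dmp I F psi DF Fpsi.
suff: forall s chi, (forall v, all (fun i => teval v (F i)) s -> teval v chi) ->
    D chi.
  move=> /(_ (enum I)); apply=> v /allP vF; apply: Fpsi => i.
  by apply: vF; rewrite mem_enum.
elim=> [|i s IHs] chi schi; first by apply: Dtaut => v; apply: schi.
apply: (Dmp (F i)) => //; apply: IHs => v vs.
by rewrite teval_Imp; apply/implyP => vi; apply: schi; rewrite /= vi.
Qed.

End Propositional.

(** * Soundness, starting with the semantic clauses over an arbitrary class of models *)

Section Soundness.
Context {L : signature}.

Section Eval.
Context {X K : Type} {str : K -> structure L} {upd : K -> X -> K}.
Implicit Types (phi psi : formula L X) (M : K) (a : agent L).

Local Notation eval := (eval str upd).

(** Truth at a fixed point is one particular propositional valuation, so facts about [teval], and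
    the truth of tautologies, transfer to [eval]. *)
Lemma eval_teval phi M a : eval phi M a = teval (fun psi => eval psi M a) phi.
Proof. by elim: phi => //= [phi ->|phi -> psi ->]. Qed.

Lemma eval_Neg phi M a : eval (Neg phi) M a = ~~ eval phi M a.
Proof. by []. Qed.

Lemma eval_And phi psi M a :
  eval (And phi psi) M a = eval phi M a && eval psi M a.
Proof. by []. Qed.

Lemma eval_Dia r phi M a :
  eval (Dia r phi) M a = [exists b, near (str M) r a b && eval phi M b].
Proof. by []. Qed.

Lemma eval_Imp phi psi M a :
  eval (Imp phi psi) M a = (eval phi M a ==> eval psi M a).
Proof. by rewrite /= negb_and negbK implybE. Qed.

Lemma eval_Iff phi psi M a :
  eval (Iff phi psi) M a = (eval phi M a == eval psi M a).
Proof. by rewrite eval_teval teval_Iff -!eval_teval. Qed.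

Lemma eval_Box r phi M a :
  eval (Box r phi) M a = [forall b, near (str M) r a b ==> eval phi M b].
Proof.
by rewrite /= negb_exists; apply: eq_forallb => b; rewrite negb_and negbK implybE.
Qed.

Lemma eval_bigAnd (I : finType) (P : pred I) (F : I -> formula L X) M a :
  eval (\big[And/Top]_(i | P i) F i) M a = [forall (i | P i), eval (F i) M a].
Proof.
rewrite eval_teval teval_bigAnd.
by apply: eq_forallb => i; rewrite -eval_teval.
Qed.

Lemma eval_bigOr_cond (I : finType) (P : pred I) (F : I -> formula L X) M a :
  eval (\big[Or/Bot]_(i | P i) F i) M a = [exists (i | P i), eval (F i) M a].
Proof.
rewrite eval_teval teval_bigOr.
by apply: eq_existsb => i; rewrite -eval_teval.
Qed.

Lemma eval_Nom M (f : nominal L -> agent L) i a :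
    (forall j, valu (str M) (inr j) = [set f j]) ->
  eval (Nom i) M a = (a == f i).
Proof. by move=> Vf; rewrite /= Vf inE. Qed.

Lemma eval_At M (f : nominal L -> agent L) i phi a :
    (forall j, valu (str M) (inr j) = [set f j]) ->
  eval (At i phi) M a = eval phi M (f i).
Proof.
move=> Vf; rewrite /= Vf; apply/existsP/idP => [[b]|phii].
  by case/andP => /eqP /set1_inj ->.
by exists (f i); rewrite eqxx.
Qed.

(** Equivalence is assumed at all models and agents because a hole below [Upd] is evaluated in the
    updated model, and one below [Dia] or [At] at another agent. *)
Lemma eval_plug (C : fcontext L X) phi psi :
    (forall M a, eval phi M a = eval psi M a) ->
  forall M a, eval (plug C phi) M a = eval (plug C psi) M a.
Proof.
move=> phipsi; elim: C => [|C IH|C IH chi|chi C IH|r C IH|i C IH|F C IH] M a //=.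
- by rewrite IH.
- by rewrite IH.
- by rewrite IH.
- by apply: eq_existsb => b; rewrite IH.
- by apply: eq_existsb => b; rewrite IH.
Qed.

Lemma eval_embed (chi : L0 L) M a : eval (embed X chi) M a = sat0 (str M) a chi.
Proof.
elim: chi a => //= [phi IH|phi IHphi psi IHpsi|r phi IH|i phi IH] a.
- by rewrite IH.
- by rewrite IHphi IHpsi.
- by apply: eq_existsb => b; rewrite IH.
- by apply: eq_existsb => b; rewrite IH.
Qed.

(** The axioms for boxes alone come from the conditions on static models. Those with nominals also
    use the naming bijection [f]: surjectivity for (Name) and (Paste), injectivity for (Dist). Since
    [X] and [upd] are arbitrary, instances containing update modalities are covered. *)
Lemma H0_axiom_sound phi : H0_axiom phi ->
  forall M, (exists S : static_model L, str M = S) -> forall a, eval phi M a.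
Proof.
move=> phiax M [S MS]; have [f fbij Vf] := static_naming S.
rewrite -MS in Vf.
case: phiax => {phi}.
- by move=> phi phitaut a; rewrite eval_teval.
- move=> r phi a; rewrite eval_Imp eval_Box; apply/implyP => /forallP /(_ a).
  by rewrite MS static_refl.
- move=> r phi a; rewrite eval_Imp eval_Box; apply/implyP => phia.
  apply/forallP => b; apply/implyP => ab /=; apply/existsP; exists a.
  by rewrite phia andbT; move: ab; rewrite MS => /static_sym.
- move=> r s phi rs a; rewrite eval_Imp !eval_Box; apply/implyP => /forallP sphi.
  apply/forallP => b; apply/implyP => ab; apply: (implyP (sphi b)).
  by move: ab; rewrite MS; apply: static_mono.
- move=> r s phi a; rewrite eval_Imp !eval_Box; apply/implyP => /forallP rsphi.
  apply/forallP => b; apply/implyP => ab; rewrite eval_Box.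
  apply/forallP => c; apply/implyP => bc; apply: (implyP (rsphi c)).
  by move: ab bc; rewrite MS; apply: static_tri.
- move=> i j a; rewrite (eval_At _ _ _ Vf) eval_Dia; apply/existsP; exists (f j).
  by rewrite (eval_Nom _ _ Vf) eqxx andbT MS static_bound.
- move=> a; rewrite eval_bigOr; have [g _ gK] := fbij.
  by apply/existsP; exists (g a); rewrite (eval_Nom _ _ Vf) gK.
- move=> r i phi a; rewrite eval_Iff eval_bigOr (eval_At _ _ _ Vf) eval_Dia.
  have [g _ gK] := fbij; apply/eqP; apply/existsP/existsP => -[].
  + move=> b /andP[ib phib]; exists (g b).
    rewrite eval_And !(eval_At _ _ _ Vf) gK phib andbT.
    rewrite eval_Dia; apply/existsP; exists b.
    by rewrite ib (eval_Nom _ _ Vf) gK eqxx.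
  + move=> j; rewrite eval_And !(eval_At _ _ _ Vf) eval_Dia.
    case/andP => /existsP[b /andP[ib]].
    by rewrite (eval_Nom _ _ Vf) => /eqP <- phib; exists b; rewrite ib.
- move=> i phi psi a; rewrite !eval_Imp !(eval_At _ _ _ Vf) eval_Imp.
  exact: implybb.
- by move=> i phi a; rewrite eval_Iff eval_Neg !(eval_At _ _ _ Vf).
- by move=> i a; rewrite (eval_At _ _ _ Vf) (eval_Nom _ _ Vf).
- by move=> i j phi a; rewrite eval_Iff !(eval_At _ _ _ Vf).
- by move=> i phi psi a; rewrite eval_Iff eval_And !(eval_At _ _ _ Vf).
- move=> i phi a; rewrite eval_Imp eval_Iff (eval_Nom _ _ Vf).
  by apply/implyP => /eqP ->; rewrite (eval_At _ _ _ Vf).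
- move=> i j ij a; rewrite (eval_At _ _ _ Vf) eval_Neg (eval_Nom _ _ Vf).
  by rewrite (bij_eq fbij).
Qed.

End Eval.

(** * Soundness of the dynamic system over network models *)

Context {R : realType} (delta : pseudometric L R) (Sigma : feed_model L -> Prop).

Implicit Types (N : network_model delta) (phi psi : LD Sigma).

Lemma network_nearE N r a b :
  near N r a b = close delta r (profile (valu N) a) (profile (valu N) b).
Proof. by apply/idP/idP => /network_near. Qed.

Lemma sat_piS N a S : sat N a (piS Sigma S) = (S == profile (valu N) a).
Proof.
rewrite /sat /= !eval_bigAnd; apply/andP/eqP => [[/forallP inS /forallP outS]|->].
  apply/setP => p; rewrite inE; apply/idP/idP => [pS|].
    exact: (implyP (inS p)).
  apply: contraTT => pS; apply: (implyP (outS p)).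
  by rewrite inE.
split; apply/forallP => p; apply/implyP; first by rewrite inE.
by rewrite !inE.
Qed.

Lemma sat0_pre_event_at N (F : feed_model L) a e :
  sat0 N a (pre e) = (e == event_at N F a).
Proof.
have prea := xchooseP (event_exists N F a).
apply/idP/eqP => [pree|->]; last exact: prea.
exact: event_unique pree prea.
Qed.

(* The guards [pre e] select the event [event_at N F a]. *)
Lemma eval_guarded N a (F : feed_model L) (chi : event F -> LD Sigma) :
  sat N a (\big[And/Top]_(e : event F) Imp (embed _ (pre e)) (chi e))
    = sat N a (chi (event_at N F a)).
Proof.
rewrite /sat eval_bigAnd; apply/forallP/idP => [/(_ (event_at N F a))|chia e].
  by rewrite eval_Imp eval_embed sat0_pre_event_at eqxx.
rewrite eval_Imp eval_embed sat0_pre_event_at; apply/implyP => _; apply/implyP.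
by move=> /eqP ->.
Qed.

Lemma sat_PF N (f : nominal L -> agent L) a F S i :
    (forall j, valu N (inr j) = [set f j]) ->
  sat N a (PF Sigma F S i) = (S == profile (update_val N F) (f i)).
Proof.
move=> Vf; rewrite /sat (eval_At _ _ _ Vf) -/(sat _ _ _) eval_guarded /sat.
rewrite [LHS]/= !eval_bigAnd.
apply/andP/eqP => [[/forallP inS /forallP outS]|->].
  (* The updated valuation is given by [sat0] of a static postcondition; passing to its embedding
     makes it match the conjuncts of [PF]. *)
  apply/setP => p; rewrite !inE -(eval_embed (str := @network_str L R delta)
    (upd := fun M (F : {F | Sigma F}) => update M (proj1_sig F))).
  apply/idP/idP => [pS|].
    exact: (implyP (inS p)).
  apply: contraTT => pS; apply: (implyP (outS p)).
  by rewrite inE.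
by split; apply/forallP => p; apply/implyP; rewrite /= !inE eval_embed.
Qed.

(** Exactly one pair of sets makes both [PF] conjuncts true, namely the updated profiles of the two
    named agents, and the range of the disjunction tests whether this pair is close. *)
Lemma sat_TF N (f : nominal L -> agent L) a F r i j :
    (forall k, valu N (inr k) = [set f k]) ->
  sat N a (TF delta Sigma F r i j) = near (update N F) r (f i) (f j).
Proof.
move=> Vf; rewrite /sat eval_bigOr_cond; apply/existsP/idP => [[[S T]]|ij].
  rewrite eval_And -!/(sat _ _ _) !(sat_PF _ _ _ _ Vf).
  by case/andP => /= ST /andP[/eqP Si /eqP Tj]; rewrite -Si -Tj.
exists (profile (update_val N F) (f i), profile (update_val N F) (f j)).
rewrite eval_And -!/(sat _ _ _) !(sat_PF _ _ _ _ Vf) !eqxx.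
by rewrite !andbT.
Qed.

Lemma HD_axiom_sound phi : HD_axiom delta phi -> forall N a, sat N a phi.
Proof.
move=> phiax N; have [f fbij Vf] := network_naming N; have [g _ gK] := fbij.
case: phiax => {phi}.
- move=> phi phiax a; apply: (H0_axiom_sound phiax).
  by exists (network_static N).
- move=> r phi a; rewrite /sat eval_Iff eval_bigOr_cond.
  apply/eqP; apply/existsP/existsP => [[b /andP[ab phib]]|[[S T]]].
    (* The true disjunct is the one for the actual profiles of [a] and [b], with [g b] as the name
       of [b]. *)
    exists (profile (valu N) a, profile (valu N) b).
    rewrite -network_nearE ab eval_And -/(sat _ _ (piS _ _)) sat_piS eqxx.
    rewrite eval_bigOr; apply/existsP; exists (g b).
    by rewrite (eval_At _ _ _ Vf) gK eval_And -/(sat _ _ (piS _ _)) sat_piS eqxx.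
  rewrite eval_And -/(sat _ _ (piS _ _)) sat_piS eval_bigOr.
  case/and3P => ST /eqP Sa /existsP[j].
  rewrite (eval_At _ _ _ Vf) eval_And -/(sat _ _ (piS _ _)) sat_piS.
  by case/andP => /eqP Tj phij; exists (f j); rewrite network_nearE -Sa -Tj ST.
- move=> F p a; rewrite /sat eval_Iff -!/(sat _ _ _) eval_guarded /sat eval_embed.
  by rewrite /= inE.
- by move=> F i a; rewrite /sat eval_Iff.
- by move=> F phi a; rewrite /sat eval_Iff.
- by move=> F phi psi a; rewrite /sat eval_Iff.
- by move=> F i phi a; rewrite /sat eval_Iff.
- move=> F r phi a; rewrite /sat eval_Iff eval_bigOr.
  apply/eqP; apply/existsP/existsP => [[b /andP[ab phib]]|[[i j]]].
    exists (g a, g b); rewrite !eval_And (eval_Nom _ _ Vf) (eval_At _ _ _ Vf).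
    by rewrite -/(sat _ _ (TF _ _ _ _ _ _)) (sat_TF _ _ _ _ _ Vf) !gK eqxx ab.
  rewrite !eval_And (eval_Nom _ _ Vf) (eval_At _ _ _ Vf).
  rewrite -/(sat _ _ (TF _ _ _ _ _ _)) (sat_TF _ _ _ _ _ Vf).
  by case/andP => /andP[/eqP -> ij] phij; exists (f j); rewrite ij.
Qed.

Lemma HD_theorem_sound phi : HD_theorem delta phi -> forall N a, sat N a phi.
Proof.
elim=> {phi} [phi|phi psi _ IHi _ IH|C phi psi _ IH|r phi _ IH|i phi _ IH] N a.
- by move=> phiax; apply: HD_axiom_sound.
- by have := IHi N a; rewrite /sat eval_Imp -!/(sat _ _ _) IH.
- rewrite /sat eval_Iff; apply/eqP; apply: eval_plug => M b.
  by apply/eqP; have := IH M b; rewrite /sat eval_Iff.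
- by rewrite /sat eval_Box; apply/forallP => b; apply/implyP => _; apply: IH.
- have [f _ Vf] := network_naming N.
  by rewrite /sat (eval_At _ _ _ Vf); apply: IH.
Qed.

Lemma HD_derives_sound (Gamma : LD Sigma -> Prop) phi :
  HD_derives delta Gamma phi -> entails delta Gamma phi.
Proof.
move=> der N a NGamma; elim: der => {phi} [phi|phi|phi psi _ IHi _ IH].
- exact: NGamma.
- by move=> phithm; apply: HD_theorem_sound.
- by move: IHi; rewrite /sat eval_Imp -!/(sat _ _ _) IH.
Qed.

End Soundness.

(** * Completeness: derived propositional rules, then state diagrams *)

Section Completeness.
Context {L : signature} {R : realType} (delta : pseudometric L R).
Context (Sigma : feed_model L -> Prop).

Local Notation label := {F : feed_model L | Sigma F}.
Local Notation state := {set nominal L * atom L}.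
Local Notation thm := (@HD_theorem L R delta Sigma).

Implicit Types (phi psi chi : LD Sigma) (T : state) (i j : nominal L).

Lemma thm_taut phi : tautology phi -> thm phi.
Proof. by move=> phitaut; apply/HD_ax/ax_H0/ax_taut. Qed.

Lemma thm_H0 phi : H0_axiom phi -> thm phi.
Proof. by move=> phiax; apply/HD_ax/ax_H0. Qed.

Lemma thm_conseq2 phi psi chi :
    (forall v, teval v phi -> teval v psi -> teval v chi) ->
  thm phi -> thm psi -> thm chi.
Proof.
move=> conseq phithm psithm.
apply: (tautological_consequence thm_taut (@HD_mp _ _ _ _)
  (F := fun b : bool => if b then phi else psi)) => [[]//|v vF].
by apply: conseq; [apply: (vF true)|apply: (vF false)].
Qed.

Lemma thm_conseq1 phi psi :
  (forall v, teval v phi -> teval v psi) -> thm phi -> thm psi.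
Proof.
by move=> conseq phithm; apply: (thm_conseq2 _ phithm phithm) => v /conseq.
Qed.

Lemma thm_Imp_trans phi psi chi :
  thm (Imp phi psi) -> thm (Imp psi chi) -> thm (Imp phi chi).
Proof.
by apply: thm_conseq2 => v; rewrite !teval_Imp => /implyP h /implyP k;
  apply/implyP => /h.
Qed.

Lemma thm_Iff_l phi psi : thm (Iff phi psi) -> thm (Imp phi psi).
Proof.
by apply: thm_conseq1 => v; rewrite teval_Iff teval_Imp => /eqP ->; apply/implyP.
Qed.

Lemma thm_Iff_sym phi psi : thm (Iff phi psi) -> thm (Iff psi phi).
Proof. by apply: thm_conseq1 => v; rewrite !teval_Iff eq_sym. Qed.

Lemma thm_Imp_weaken phi psi : thm psi -> thm (Imp phi psi).
Proof. by apply: thm_conseq1 => v; rewrite teval_Imp => ->; rewrite implybT. Qed.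

Lemma thm_Imp_Iff phi psi chi :
  thm (Iff psi chi) -> thm (Imp phi psi) -> thm (Imp phi chi).
Proof. by move=> /thm_Iff_l h k; apply: thm_Imp_trans k h. Qed.

Lemma thm_Iff_Neg phi psi :
  thm (Iff phi psi) -> thm (Iff (Neg phi) (Neg psi)).
Proof. by apply: thm_conseq1 => v; rewrite !teval_Iff /= => /eqP ->. Qed.

Definition literal T (x : nominal L * atom L) : LD Sigma :=
  if x \in T then At x.1 (Atom x.2) else Neg (At x.1 (Atom x.2)).

Definition diagram T i : LD Sigma := And (Nom i) (\big[And/Top]_x literal T x).

Lemma diagram_Nom T i : thm (Imp (diagram T i) (Nom i)).
Proof. by apply: thm_taut => v; rewrite teval_Imp; apply/implyP => /andP[]. Qed.

Lemma diagram_literal T i x : thm (Imp (diagram T i) (literal T x)).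
Proof.
apply: thm_taut => v; rewrite teval_Imp teval_And teval_bigAnd.
by apply/implyP => /andP[_ /forallP /(_ x)].
Qed.

(** * Normal modalities, to be instantiated by [At j] and by [Upd F] *)

Section Normal.
Context (box : LD Sigma -> LD Sigma).
Hypothesis box_nec : forall phi, thm phi -> thm (box phi).
Hypothesis box_K : forall phi psi,
  thm (Imp (box (Imp phi psi)) (Imp (box phi) (box psi))).

Lemma box_mono phi psi : thm (Imp phi psi) -> thm (Imp (box phi) (box psi)).
Proof. by move=> /box_nec; apply: HD_mp. Qed.

Lemma box_And chi phi psi :
    thm (Imp chi (box phi)) -> thm (Imp chi (box psi)) ->
  thm (Imp chi (box (And phi psi))).
Proof.
move=> chiphi chipsi.
have phi_conj : thm (Imp phi (Imp psi (And phi psi))).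
  by apply: thm_taut => v; rewrite !teval_Imp /=; do 2!case: teval.
have chi_imp := thm_Imp_trans (thm_Imp_trans chiphi (box_mono phi_conj)) (box_K _ _).
apply: thm_conseq2 chi_imp chipsi => v; rewrite !teval_Imp.
by case: teval => //=; do 2!case: teval.
Qed.

(** A normal modality distributes over finite conjunctions, so a boxed diagram can be proved one
    conjunct at a time. *)
Lemma box_diagram chi T i :
    thm (Imp chi (box (Nom i))) ->
    (forall x, thm (Imp chi (box (literal T x)))) ->
  thm (Imp chi (box (diagram T i))).
Proof.
move=> chi_i chi_lit; apply: box_And => //.
apply: (big_ind (fun psi => thm (Imp chi (box psi)))) => //; last exact: box_And.
by apply/thm_Imp_weaken/box_nec/thm_taut => v /=; rewrite andbN.
Qed.

End Normal.

Lemma At_K i phi psi : thm (Imp (At i (Imp phi psi)) (Imp (At i phi) (At i psi))).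
Proof. exact/thm_H0/ax_KAt. Qed.

(** [Imp] abbreviates a combination of [Neg] and [And], with both of which an update commutes. *)
Lemma Upd_Imp (F : label) phi psi :
  thm (Iff (Upd F (Imp phi psi)) (Imp (Upd F phi) (Upd F psi))).
Proof.
have UpdN chi := HD_ax (ax_UpdNeg delta F chi).
have UpdA : thm (Iff (Upd F (And phi (Neg psi)))
                     (And (Upd F phi) (Neg (Upd F psi)))).
  apply: thm_conseq2 (UpdN psi) (HD_ax (ax_UpdAnd delta F phi (Neg psi))) => v.
  by rewrite !teval_Iff !teval_And => /eqP ->.
apply: thm_conseq2 (UpdN (And phi (Neg psi))) UpdA => v.
rewrite !teval_Iff teval_Imp /= => /eqP -> /eqP ->.
by rewrite negb_and negbK implybE.
Qed.

Lemma Upd_K (F : label) phi psi :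
  thm (Imp (Upd F (Imp phi psi)) (Imp (Upd F phi) (Upd F psi))).
Proof. exact/thm_Iff_l/Upd_Imp. Qed.

(* There is no necessitation rule for updates: replace [phi] by the provably
   equivalent tautology [phi -> phi], over which the update distributes. *)
Lemma Upd_nec (F : label) phi : thm phi -> thm (Upd F phi).
Proof.
move=> phithm; pose Id := Imp phi phi.
have Iff_Id : thm (Iff Id phi).
  by apply: thm_conseq1 phithm => v vphi; rewrite teval_Iff teval_Imp implybb vphi.
have UpdId : thm (Upd F Id).
  by apply: thm_conseq1 (Upd_Imp F phi phi) => v;
    rewrite teval_Iff teval_Imp implybb => /eqP.
exact: HD_mp (thm_Iff_l (HD_repl (CUpd F (CHole _ _)) Iff_Id)) UpdId.
Qed.

(** The literals are facts about named agents, which by (Agree) do not depend on the point of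
    evaluation. Only the nominal changes, and (Ref) supplies the new one. *)
Lemma At_diagram T i j : thm (Imp (diagram T i) (At j (diagram T j))).
Proof.
have At_nec phi : thm phi -> thm (At j phi) by apply: HD_gen.
apply: (box_diagram At_nec (At_K j)) => [|[k p]].
  exact/thm_Imp_weaken/thm_H0/ax_RefAt.
have Agree := thm_Iff_sym (thm_H0 (ax_Agree j k (Atom p))).
have := diagram_literal T i (k, p); rewrite /literal /=; case: ifP => _ h.
  exact: thm_Imp_Iff h.
apply: thm_Imp_Iff (thm_H0 (ax_Self _ _)) _.
exact: thm_Imp_Iff (thm_Iff_Neg Agree) h.
Qed.

(** * Every diagram decides every formula *)

Definition decides phi : Prop :=
  forall T i, thm (Imp (diagram T i) phi) \/ thm (Imp (diagram T i) (Neg phi)).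

Lemma decides_Iff phi psi : thm (Iff psi phi) -> decides phi -> decides psi.
Proof.
move=> /thm_Iff_sym h phidec T i; case: (phidec T i) => k; [left|right].
  exact: thm_Imp_Iff k.
exact: thm_Imp_Iff (thm_Iff_Neg h) k.
Qed.

Lemma decides_Neg phi : decides phi -> decides (Neg phi).
Proof.
move=> phidec T i; case: (phidec T i) => k; [right|left] => //.
by apply: thm_conseq1 k => v; rewrite !teval_Imp /= negbK.
Qed.

Lemma decides_And phi psi : decides phi -> decides psi -> decides (And phi psi).
Proof.
move=> phidec psidec T i.
case: (phidec T i) => h; last first.
  right; apply: thm_conseq1 h => v; rewrite !teval_Imp.
  by case: (teval v (diagram T i)) => //=; do ?case: teval.
case: (psidec T i) => k; [left|right]; apply: thm_conseq2 h k => v;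
  by rewrite !teval_Imp; case: (teval v (diagram T i)) => //=; do ?case: teval.
Qed.

Lemma decides_Or phi psi : decides phi -> decides psi -> decides (Or phi psi).
Proof. by move=> *; apply/decides_Neg/decides_And; apply: decides_Neg. Qed.

Lemma decides_Imp phi psi : decides phi -> decides psi -> decides (Imp phi psi).
Proof. by move=> *; apply/decides_Neg/decides_And => //; apply: decides_Neg. Qed.

(** Moving to the agent named [j] keeps the table [T], so the verdict of [diagram T j] on [phi] is
    the one needed; (Self) brings a negative verdict outside. *)
Lemma decides_At j phi : decides phi -> decides (At j phi).
Proof.
move=> phidec T i; have At_mono := box_mono (@HD_gen _ _ _ _ j) (At_K j).
case: (phidec T j) => /At_mono h; [left|right].
  exact: thm_Imp_trans (At_diagram T i j) h.
apply: thm_Imp_Iff (thm_Iff_sym (thm_H0 (ax_Self j phi))) _.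
exact: thm_Imp_trans (At_diagram T i j) h.
Qed.

Lemma thm_Locality T i phi : thm (Imp (diagram T i) (Iff (At i phi) phi)).
Proof.
apply: thm_Imp_trans (diagram_Nom T i) _.
apply: thm_conseq1 (thm_H0 (ax_Locality i phi)) => v.
by rewrite !teval_Imp !teval_Iff eq_sym.
Qed.

(** The diagram says that the current agent is [i], so (Locality) removes the operator. This turns
    literals, and (Dist), into verdicts on atoms and nominals. *)
Lemma diagram_At T i phi : thm (Imp (diagram T i) (At i phi)) ->
  thm (Imp (diagram T i) phi).
Proof.
apply: thm_conseq2 (thm_Locality T i phi) => v; rewrite !teval_Imp teval_Iff.
by case: (teval v (diagram T i)) => //= /eqP ->.
Qed.

Lemma decides_Atom p : decides (Atom p).
Proof.
move=> T i; have := diagram_literal T i (i, p); rewrite /literal /=.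
case: ifP => _ h; [left|right]; apply: diagram_At => //.
exact: thm_Imp_Iff (thm_H0 (ax_Self _ _)) h.
Qed.

Lemma decides_Nom j : decides (Nom j).
Proof.
move=> T i; have [<-|ij] := eqVneq i j; first by left; apply: diagram_Nom.
by right; apply/diagram_At/thm_Imp_weaken/thm_H0/ax_Dist.
Qed.

Lemma decides_Bot : decides Bot.
Proof. by apply: decides_And; last apply: decides_Neg; apply: decides_Atom. Qed.

Lemma decides_bigAnd (I : finType) (P : pred I) (F : I -> LD Sigma) :
  (forall k, P k -> decides (F k)) -> decides (\big[And/Top]_(k | P k) F k).
Proof.
by apply: big_ind; [apply/decides_Neg/decides_Bot|apply: decides_And].
Qed.

Lemma decides_bigOr (I : finType) (P : pred I) (F : I -> LD Sigma) :
  (forall k, P k -> decides (F k)) -> decides (\big[Or/Bot]_(k | P k) F k).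
Proof. by apply: big_ind; [apply: decides_Bot|apply: decides_Or]. Qed.

Lemma decides_Dia r phi : decides phi -> decides (Dia r phi).
Proof.
move=> phidec; have piSdec S : decides (piS Sigma S).
  apply: decides_And; apply: decides_bigAnd => p _; last apply: decides_Neg;
    exact: decides_Atom.
apply: decides_Iff (HD_ax (ax_Net delta r phi)) _; apply: decides_bigOr => U _.
apply: decides_And => //; apply: decides_bigOr => j _.
by apply/decides_At/decides_And.
Qed.

Lemma decides_embed (chi : L0 L) : decides (embed label chi).
Proof.
elim: chi => [p|i|chi|chi dchi psi|r chi|i chi|[]] /=.
- exact: decides_Atom.
- exact: decides_Nom.
- exact: decides_Neg.
- exact: decides_And.
- exact: decides_Dia.
- exact: decides_At.
Qed.

(** Once the update is moved below [At], its reduction for atoms leaves only static pre- and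
    postconditions, which are already decided. *)
Lemma decides_Upd_At_Atom (F : label) j p : decides (Upd F (At j (Atom p))).
Proof.
apply: decides_Iff (HD_ax (ax_UpdAt delta F j _)) _; apply: decides_At.
apply: decides_Iff (HD_ax (ax_UpdAtom delta F p)) _; apply: decides_bigAnd => e _.
by apply: decides_Imp; apply: decides_embed.
Qed.

Lemma Upd_diagram (F : label) T i :
  exists T', thm (Imp (diagram T i) (Upd F (diagram T' i))).
Proof.
(* The new table collects the facts that the old diagram proves to hold after the update;
   provability is made Boolean classically. For every other pair the old diagram proves the
   negation, since it decides the fact. The name [i] survives the update. *)
exists [set x | `[< thm (Imp (diagram T i) (Upd F (At x.1 (Atom x.2)))) >]].
apply: (box_diagram (@Upd_nec F) (Upd_K F)) => [|[j p]].
  exact: thm_Imp_Iff (thm_Iff_sym (HD_ax (ax_UpdNom delta F i))) (diagram_Nom T i).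
rewrite /literal inE /=; case: asboolP => // not_h.
have [//|h] := decides_Upd_At_Atom F j p T i.
exact: thm_Imp_Iff (thm_Iff_sym (HD_ax (ax_UpdNeg delta F _))) h.
Qed.

Lemma decides_Upd (F : label) phi : decides phi -> decides (Upd F phi).
Proof.
move=> phidec T i; have [T' h] := Upd_diagram F T i.
have Upd_mono := box_mono (@Upd_nec F) (Upd_K F).
case: (phidec T' i) => /Upd_mono k; [left|right].
  exact: thm_Imp_trans h k.
exact: thm_Imp_Iff (HD_ax (ax_UpdNeg delta F phi)) (thm_Imp_trans h k).
Qed.

Lemma decides_all phi : decides phi.
Proof.
elim: phi => [p|i|phi|phi dphi psi|r phi|i phi|F phi].
- exact: decides_Atom.
- exact: decides_Nom.
- exact: decides_Neg.
- exact: decides_And.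
- exact: decides_Dia.
- exact: decides_At.
- exact: decides_Upd.
Qed.

(** Any table [T] can be read as a valuation along a bijection from nominals to agents. Nearness is
    then defined from the resulting profiles, so the structure is a network model by
    construction. *)
Lemma diagram_satisfiable T i :
  exists (N : network_model delta) (a : agent L), sat N a (diagram T i).
Proof.
have [f fbij] : exists f : nominal L -> agent L, bijective f.
  (* Nominals and agents are equinumerous, so they are matched by their ranks in the
     enumerations. *)
  exists (fun j => enum_val (cast_ord (card_nominal L) (enum_rank j))).
  apply: (bij_comp (enum_val_bij _)).
  apply: (bij_comp (f := cast_ord _)); last exact: enum_rank_bij.
  by exists (cast_ord (esym (card_nominal L))); [apply: cast_ordK|apply: cast_ordKV].
pose V (x : atom L + nominal L) : {set agent L} := match x with
  | inl p => [set a | [exists j, (f j == a) && ((j, p) \in T)]]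
  | inr j => [set f j] end.
pose S := Structure (fun r a b => close delta r (profile V a) (profile V b)) V.
have Snaming : naming (valu S) by exists f.
pose N : network_model delta :=
  @NetworkModel L R delta S Snaming (fun _ _ _ => iff_refl _).
have Vf j : valu N (inr j) = [set f j] by [].
have At_p j p : sat N (f i) (At j (Atom p) : LD Sigma) = ((j, p) \in T).
  rewrite /sat (eval_At _ _ _ Vf) /= inE.
  apply/existsP/idP => [[k /andP[]]|jp]; last by exists j; rewrite eqxx.
  by rewrite (bij_eq fbij) => /eqP ->.
exists N, (f i); rewrite /sat eval_And (eval_Nom _ _ Vf) eqxx eval_bigAnd.
apply/forallP => -[j p]; apply/implyP => _; rewrite /literal.
by case: ifP => jp; rewrite ?eval_Neg -/(sat _ _ (At _ _)) At_p jp.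
Qed.

Lemma HD_complete (Gamma : LD Sigma -> Prop) phi :
  entails delta Gamma phi -> HD_derives delta Gamma phi.
Proof.
move=> Gphi.
have der_taut chi : tautology chi -> HD_derives delta Gamma chi.
  by move=> /thm_taut; apply: der_thm.
have conseq := tautological_consequence der_taut (@der_mp _ _ _ _ Gamma).
have diagram_phi T i : HD_derives delta Gamma (Imp (diagram T i) phi).
  have [h|h] := decides_all phi T i; first exact: der_thm.
  have [N [a NTi]] := diagram_satisfiable T i.
  have not_phi : ~~ sat N a phi.
    have := HD_theorem_sound h N a.
    by rewrite /sat eval_Imp -!/(sat _ _ _) NTi.
  (* A model of the diagram falsifies [phi], so by the entailment it cannot satisfy all of
     [Gamma]. *)
  have [gamma Ggamma not_gamma] : exists2 gamma, Gamma gamma & ~~ sat N a gamma.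
    apply: contrapT => no_gamma; move/negP: not_phi; apply.
    apply: Gphi => gamma Ggamma.
    by apply: contrapT => /negP ngamma; apply: no_gamma; exists gamma.
  (* By soundness the diagram cannot prove [gamma], which fails at its model. Hence it refutes
     [gamma], and together with [Gamma] it implies anything. *)
  have [k|k] := decides_all gamma T i.
    have := HD_theorem_sound k N a.
    by rewrite /sat eval_Imp -!/(sat _ _ _) NTi (negbTE not_gamma).
  pose F (b : bool) := if b then gamma else Imp (diagram T i) (Neg gamma).
  apply: (conseq _ F).
    by case; [apply: der_hyp|apply: der_thm].
  move=> v vF; have := vF true; have := vF false; rewrite !teval_Imp.
  by case: (teval v (diagram T i)) => //= /negbTE ->.
(* Finitely many premises suffice: one implication for each diagram, and (Name) at [None]. *)
pose F (s : option (state * nominal L)) : LD Sigma :=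
  if s is Some (T, i) then Imp (diagram T i) phi else \big[Or/Bot]_i Nom i.
apply: (conseq _ F) => [[[T i]|]|v vF] //.
- exact: diagram_phi.
- exact/der_thm/thm_H0/ax_Name.
have := vF None; rewrite /= teval_bigOr => /existsP[i /= vi].
(* The valuation [v] makes some nominal [i] true; collecting the literals it makes true gives a
   diagram that it satisfies. *)
pose T := [set x | v (At x.1 (Atom x.2))].
have := vF (Some (T, i)); rewrite /F teval_Imp => /implyP; apply.
rewrite teval_And teval_bigAnd; apply/andP; split=> //.
apply/forallP => x; apply/implyP => _.
by rewrite /literal inE; case: ifP => //= ->.
Qed.

End Completeness.

Theorem theorem4p4 (L : signature) (R : realType) (delta : pseudometric L R)
    (Sigma : feed_model L -> Prop) (Gamma : LD Sigma -> Prop)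
    (phi : LD Sigma) :
  HD_derives delta Gamma phi <-> entails delta Gamma phi.
Proof. by split; [apply: HD_derives_sound|apply: HD_complete]. Qed.
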